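(* Let $\mathcal{H}$ be a finite-dimensional Hilbert space, let $\mathcal{E}$ be a quantum channel on $\mathcal{L}(\mathcal{H})$, and let $\mathcal{C}=\mathcal{A}\otimes\mathcal{B}\subseteq\mathcal{H}$ be a subspace. The following are equivalent: (1) the subsystem $\mathcal{B}$ is correctable for $\mathcal{E}$; (2) there is a $*$-homomorphism $\pi:\mathfrak{A}_{\mathcal{B}}\to\mathcal{L}(\mathcal{H})$ such that $$\mathcal{E}(\rho)=\pi(\rho)\,\mathcal{E}(P_{\mathcal{C}})=\mathcal{E}(P_{\mathcal{C}})\,\pi(\rho)\quad\text{for all }\rho\in\mathfrak{A}_{\mathcal{B}}.$$
   Context: A quantum channel is a completely positive trace-preserving linear map. $\mathcal{H}=(\mathcal{A}\otimes\mathcal{B})\oplus\mathcal{C}^\perp$; for operators $X$ on $\mathcal{A}$ and $Y$ on $\mathcal{B}$, $X\otimes Y$ denotes $(X\otimes Y)\oplus 0_{\mathcal{C}^\perp}$ on $\mathcal{H}$. $P_{\mathcal{C}}=I_{\mathcal{A}}\otimes I_{\mathcal{B}}$ is the projection onto $\mathcal{C}$ and $\mathcal{P}_{\mathcal{C}}(\rho)=P_{\mathcal{C}}\rho P_{\mathcal{C}}$. $\mathfrak{A}_{\mathcal{B}}:=\{I_{\mathcal{A}}\otimes\rho_{\mathcal{B}}:\rho_{\mathcal{B}}\in\mathcal{L}(\mathcal{B})\}$ (so $P_{\mathcal{C}}\in\mathfrak{A}_{\mathcal{B}}$). A $*$-homomorphism is a linear map preserving products and adjoints (not necessarily unital). The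 subsystem $\mathcal{B}$ is correctable for $\mathcal{E}$ if there are a quantum channel $\mathcal{R}$ on $\mathcal{L}(\mathcal{H})$ and a quantum channel $\mathcal{F}_{\mathcal{A}}$ on $\mathcal{L}(\mathcal{A})$ with $\mathcal{R}\circ\mathcal{E}\circ\mathcal{P}_{\mathcal{C}}=(\mathcal{F}_{\mathcal{A}}\otimes\mathrm{id}_{\mathcal{B}})\circ\mathcal{P}_{\mathcal{C}}$. *)

(* Defs.v *)
From HB Require Import structures.
From mathcomp Require Import all_boot all_order all_algebra.
Set Implicit Arguments. Unset Strict Implicit. Unset Printing Implicit Defensive.
Import Order.TTheory GRing.Theory Num.Theory.
Local Open Scope ring_scope.

Section QDefs.
Variable C : numClosedFieldType.

(* Index splitting 'I_(m*n) ~ 'I_m * 'I_n (inverse of mxvec_index). *)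
Definition ipair (m n : nat) (p : 'I_(m * n)) : 'I_m * 'I_n :=
  enum_val (cast_ord (esym (@mxvec_cast m n)) p).

Definition adj (m n : nat) (X : 'M[C]_(m, n)) : 'M[C]_(n, m) := (map_mx Num.conj X)^T.

Definition psd (n : nat) (X : 'M[C]_n) : Prop :=
  forall v : 'cV[C]_n, 0 <= (adj v *m X *m v) 0 0.

Definition kron (m n : nat) (X : 'M[C]_m) (Y : 'M[C]_n) : 'M[C]_(m * n) :=
  \matrix_(p, q) (X (ipair p).1 (ipair q).1 * Y (ipair p).2 (ipair q).2).

Definition tens_id (n k : nat) (F : 'M[C]_n -> 'M[C]_n) (Z : 'M[C]_(n * k))
  : 'M[C]_(n * k) :=
  \matrix_(p, q)
    F (\matrix_(a, a') Z (mxvec_index a (ipair p).2) (mxvec_index a' (ipair q).2))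
      (ipair p).1 (ipair q).1.

Definition is_linear_map (n : nat) (F : 'M[C]_n -> 'M[C]_n) : Prop :=
  forall (a : C) (X Y : 'M[C]_n), F (a *: X + Y) = a *: F X + F Y.

Definition positive_map (n : nat) (F : 'M[C]_n -> 'M[C]_n) : Prop :=
  forall X, psd X -> psd (F X).

Definition completely_positive (n : nat) (F : 'M[C]_n -> 'M[C]_n) : Prop :=
  forall k : nat, positive_map (@tens_id n k F).

Definition trace_preserving (n : nat) (F : 'M[C]_n -> 'M[C]_n) : Prop :=
  forall X, \tr (F X) = \tr X.

Definition quantum_channel (n : nat) (F : 'M[C]_n -> 'M[C]_n) : Prop :=
  [/\ is_linear_map F, completely_positive F & trace_preserving F].

(* H = (A (x) B) (+) C^perp with dim A = na, dim B = nb, dim C^perp = nc.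
   An operator Z on A (x) B is viewed on H as Z (+) 0. *)
Definition emb (na nb nc : nat) (Z : 'M[C]_(na * nb)) : 'M[C]_(na * nb + nc) :=
  block_mx Z 0 0 0.

Definition PC (na nb nc : nat) : 'M[C]_(na * nb + nc) :=
  emb nc (kron (1%:M : 'M[C]_na) (1%:M : 'M[C]_nb)).

Definition projC (na nb nc : nat) (rho : 'M[C]_(na * nb + nc)) : 'M[C]_(na * nb + nc) :=
  PC na nb nc *m rho *m PC na nb nc.

Definition correctable_subsystem (na nb nc : nat)
  (E : 'M[C]_(na * nb + nc) -> 'M[C]_(na * nb + nc)) : Prop :=
  exists (R : 'M[C]_(na * nb + nc) -> 'M[C]_(na * nb + nc))
         (FA : 'M[C]_na -> 'M[C]_na),
    [/\ quantum_channel R, quantum_channel FA &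
      forall rho : 'M[C]_(na * nb + nc),
        R (E (projC rho)) = emb nc (@tens_id na nb FA (ulsubmx (projC rho)))].

Definition in_AB (na nb nc : nat) (X : 'M[C]_(na * nb + nc)) : Prop :=
  exists rhoB : 'M[C]_nb, X = emb nc (kron (1%:M : 'M[C]_na) rhoB).

(* pi is a *-homomorphism on A_B (values off A_B are irrelevant). *)
Definition star_hom_on_AB (na nb nc : nat)
  (pi : 'M[C]_(na * nb + nc) -> 'M[C]_(na * nb + nc)) : Prop :=
  [/\ (forall (a : C) X Y, @in_AB na nb nc X -> @in_AB na nb nc Y ->
         pi (a *: X + Y) = a *: pi X + pi Y),
      (forall X Y, @in_AB na nb nc X -> @in_AB na nb nc Y -> pi (X *m Y) = pi X *m pi Y) &
      (forall X, @in_AB na nb nc X -> pi (adj X) = adj (pi X))].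

End QDefs.

(* Main.v *)
(* Let K_r be Kraus operators of E, P = P_C and Q = E(P).

   (2) => (1): the sum over r of D_r D_r^* with D_r = K_r (1 (x) Y) - pi(1 (x) Y) K_r P
   vanishes, so K_r (1 (x) Y) = pi(1 (x) Y) K_r P for every r, whence
   tr (E(P rho P) pi(1 (x) Y)) = tr (P rho P (1 (x) Y)).  The reduced state on B is thus
   read off E(P rho P) by the matrix units pi(1 (x) e_ij), and re-preparing it next to a
   fixed state of A is a channel that corrects B.

   (1) => (2): if T_s are Kraus operators of the recovery, the same argument applied to
   the composite gives T_s K_r (1 (x) Y) = (1 (x) Y) T_s K_r P.  As the T_s^* T_s sum to 1,
   K_r (1 (x) Y) = theta(1 (x) Y) K_r P where theta(X) is the sum of the T_s^* X T_s.
   Then theta(1 (x) Y) commutes with Q and is multiplicative in Y up to a factor Q, so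
   cutting it down by the range projection of Q yields the *-homomorphism. *)

Require Import Defs.
From HB Require Import structures.
From mathcomp Require Import all_boot all_order all_algebra ring.
Import GRing.Theory Num.Theory.
Local Open Scope ring_scope.

Set Implicit Arguments.
Unset Strict Implicit.
Unset Printing Implicit Defensive.

(** * Adjoints, traces and matrix units *)

Section Adjoint.
Variable C : numClosedFieldType.

Lemma adjE m n (X : 'M[C]_(m, n)) i j : adj X i j = (X j i)^*.
Proof. by rewrite !mxE. Qed.

Lemma adjK m n (X : 'M[C]_(m, n)) : adj (adj X) = X.
Proof. by apply/matrixP => i j; rewrite !adjE conjCK. Qed.

Lemma adjM m n p (X : 'M[C]_(m, n)) (Y : 'M_(n, p)) :
  adj (X *m Y) = adj Y *m adj X.
Proof. by rewrite /adj map_mxM trmx_mul. Qed.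

Lemma adjB m n (X Y : 'M[C]_(m, n)) : adj (X - Y) = adj X - adj Y.
Proof. by rewrite /adj map_mxB linearB. Qed.

Lemma adj0 m n : adj (0 : 'M[C]_(m, n)) = 0.
Proof. by rewrite /adj map_mx0 trmx0. Qed.

Lemma adj1 n : adj (1%:M : 'M[C]_n) = 1%:M.
Proof. by rewrite /adj map_mx1 trmx1. Qed.

Lemma adjD m n (X Y : 'M[C]_(m, n)) : adj (X + Y) = adj X + adj Y.
Proof. by rewrite /adj map_mxD linearD. Qed.

Lemma adjZ m n c (X : 'M[C]_(m, n)) : adj (c *: X) = c^* *: adj X.
Proof. by rewrite /adj map_mxZ linearZ. Qed.

Lemma adj_sum (I : finType) m n (X : I -> 'M[C]_(m, n)) :
  adj (\sum_i X i) = \sum_i adj (X i).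
Proof. exact: (big_morph _ (@adjD m n) (@adj0 m n)). Qed.

Lemma adj_delta m n i j : adj (delta_mx i j : 'M[C]_(m, n)) = delta_mx j i.
Proof. by rewrite /adj map_delta_mx trmx_delta. Qed.

Lemma mulmx_adj_ge0 m n (X : 'M[C]_(m, n)) i : 0 <= (X *m adj X) i i.
Proof. by rewrite mxE sumr_ge0 // => j _; rewrite adjE -normCK exprn_ge0. Qed.

(** The diagonal entries of the sum are sums of squared moduli of entries, all of which must then
    vanish. *)
Lemma sum_mulmx_adj_eq0 (I : finType) m n (M : I -> 'M[C]_(m, n)) :
  \sum_r M r *m adj (M r) = 0 -> forall r, M r = 0.
Proof.
move=> M0 r; apply/matrixP => i j; rewrite mxE.
have /eqP := congr1 (fun X : 'M_m => X i i) M0.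
rewrite summxE mxE psumr_eq0 => [/allP/(_ r)|s _]; last exact: mulmx_adj_ge0.
rewrite mem_index_enum mxE => /(_ isT); rewrite psumr_eq0 => [/allP/(_ j)|k _].
  by rewrite mem_index_enum adjE -normCK sqrf_eq0 normr_eq0 => /(_ isT)/eqP.
by rewrite adjE -normCK exprn_ge0.
Qed.

(** Kraus form of tracing out and preparing a matrix unit; it is how trace coefficients are
    recognised as Kraus sums below. *)
Lemma sum_delta_tr m n p (i : 'I_m) (j : 'I_p) (W : 'M[C]_n) :
  \sum_k delta_mx i k *m W *m delta_mx k j = \tr W *: delta_mx i j.
Proof.
apply/matrixP => a b; rewrite summxE !mxE /mxtrace mulr_suml.
apply: eq_bigr => k _; rewrite mxE (bigD1 k) //= big1 => [|l /negPf nk].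
  rewrite mxE (bigD1 k) //= big1 => [|l /negPf nk]; last first.
    by rewrite !mxE nk andbF mul0r.
  by rewrite !mxE !eqxx !addr0 andbT mulrAC -natrM mulnb mulrC.
by rewrite [X in _ * X]mxE nk mulr0.
Qed.

Lemma tr_adj_mul m n p (X : 'M[C]_(m, n)) (W : 'M_(n, p)) (Y : 'M_(m, p)):
  \tr (X *m W *m adj Y) = \tr (W *m (adj Y *m X)).
Proof. by rewrite -mulmxA mxtrace_mulC mulmxA. Qed.

Lemma eq_mxtrace m n (X Y : 'M[C]_(m, n)) :
  (forall Z, \tr (X *m Z) = \tr (Y *m Z)) -> X = Y.
Proof.
move=> eqXY; apply/matrixP => i j.
have trE W : \tr (W *m (delta_mx j i : 'M[C]_(n, m))) = W i j.
  rewrite /mxtrace (bigD1 i) //= big1 ?addr0 => [|k /negPf nk].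
    rewrite mxE (bigD1 j) //= big1 ?addr0 => [|k /negPf nk].
      by rewrite mxE !eqxx mulr1.
    by rewrite mxE nk mulr0.
  by rewrite mxE big1 // => l _; rewrite mxE nk andbF mulr0.
by rewrite -!trE eqXY.
Qed.

End Adjoint.

(** * Spectral theory of positive and Hermitian matrices *)

Section Spectral.
Variable C : numClosedFieldType.

(** In [C] the relation [0 <= x] forces [x] to be real, so the quadratic form is real and
    polarization gives Hermitian symmetry. *)
Lemma psd_adj n (X : 'M[C]_n) : psd X -> adj X = X.
Proof.
move=> psdX; apply/matrixP => i j; rewrite adjE.
have entry a b : ((delta_mx 0 a : 'rV_n) *m X *m (delta_mx b 0 : 'cV_n)) 0 0 = X a b.
  by rewrite -rowE -colE !mxE.
have diag_real a : (X a a)^* = X a a.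
  by rewrite -entry -adj_delta (geC0_conj (psdX _)).
(* Positivity on [e_i + c e_j]; the values [c = 1, 'i] suffice. *)
have cross c : (c * X i j + c^* * X j i)^* = c * X i j + c^* * X j i.
  have := geC0_conj (psdX (delta_mx i 0 + c *: delta_mx j 0)).
  have -> : (adj (delta_mx i 0 + c *: delta_mx j 0) *m X *m
      (delta_mx i 0 + c *: delta_mx j 0) : 'M_1) 0 0 =
      (X i i + c * c^* * X j j) + (c * X i j + c^* * X j i).
    rewrite adjD adjZ !adj_delta !(mulmxDl, mulmxDr) -!scalemxAl -!scalemxAr.
    rewrite !(entry, mxE); ring.
  have diagc : (X i i + c * c^* * X j j)^* = X i i + c * c^* * X j j.
    by rewrite rmorphD !rmorphM /= conjCK [c^* * c]mulrC !diag_real.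
  by rewrite rmorphD /= diagc => /addrI.
have := cross 'i; have := cross 1.
rewrite !rmorphD !rmorphM /= !conjCK conjC1 !conjCi !mul1r !mulNr => sum_real.
rewrite -!mulrN -!mulrDr => /(mulfI (neq0Ci _)) diff_real.
apply: (@mulfI _ 2%:R); first by rewrite pnatr_eq0.
have := congr2 +%R sum_real diff_real; set a := X i j; set b := X j i => eq_ab.
have -> : 2 * b^* = a^* + b^* + (- a^* + b^*) by ring.
by rewrite eq_ab; ring.
Qed.

Lemma adj_spectral n (X : 'M[C]_n) : adj X = X ->
  exists (U : 'M[C]_n) (d : 'rV[C]_n),
    [/\ adj U *m U = 1%:M, U *m adj U = 1%:M & X = adj U *m diag_mx d *m U].
Proof.
move=> hX; have normX : X \is normalmx.
  by apply/normalmxP; rewrite -map_trmx -/(adj X) hX.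
have /orthomx_spectralP XE := normX.
have unitU := spectral_unitarymx X; have /unitarymxP UU := unitU.
exists (spectralmx X), (spectral_diag X); rewrite /adj map_trmx.
by rewrite -invmx_unitary // mulVmx ?mulmxV ?spectral_unit.
Qed.

(** The [w r] are orthonormal eigenvectors scaled by the square roots of their eigenvalues, which
    are nonnegative by testing [X] on those eigenvectors. *)
Lemma psd_sum_adj n (X : 'M[C]_n) : psd X ->
  exists w : 'I_n -> 'cV[C]_n, X = \sum_r w r *m adj (w r).
Proof.
move=> psdX; have [U [d [VU UV XE]]] := adj_spectral (psd_adj psdX).
have d_ge0 r : 0 <= d 0 r.
  have := psdX (adj U *m delta_mx r 0).
  rewrite adjM adjK adj_delta XE -!mulmxA [U *m _]mulmxA UV mul1mx.
  rewrite [U *m _]mulmxA UV mul1mx mulmxA -rowE -colE !mxE eqxx mulr1n.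
  by [].
exists (fun r => sqrtC (d 0 r) *: (adj U *m delta_mx r 0)).
rewrite XE diag_mx_sum_delta mulmx_sumr mulmx_suml; apply: eq_bigr => r _.
rewrite adjZ adjM adjK adj_delta geC0_conj ?sqrtC_ge0 //.
rewrite -[in RHS]scalemxAl -[in RHS]scalemxAr scalerA -expr2 sqrtCK.
rewrite -scalemxAr -scalemxAl -(mul_delta_mx (0 : 'I_1)); congr (_ *: _).
by rewrite !mulmxA.
Qed.

(* [S] is the pseudo-inverse of [Q], so [Q *m S] projects onto the range of [Q]. *)
Lemma adj_pinv n (Q : 'M[C]_n) : adj Q = Q ->
  exists S : 'M[C]_n,
    [/\ S *m Q = Q *m S, adj (Q *m S) = Q *m S & Q *m S *m Q = Q].
Proof.
move=> hQ; have [U [d [VU UV QE]]] := adj_spectral hQ.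
pose g (e : 'rV[C]_n) := adj U *m diag_mx e *m U.
have gM e f : g e *m g f = g (\row_j (e 0 j * f 0 j)).
  rewrite /g -!mulmxA [U *m (_ *m _)]mulmxA UV mul1mx [diag_mx e *m _]mulmxA.
  by rewrite mulmx_diag.
(* The convention [0^-1 = 0] matters: it makes each product of an eigenvalue with its inverse equal
   to 0 or 1, so that [Q *m S] is a projection. *)
pose f : 'rV[C]_n := \row_j (d 0 j)^-1.
exists (g f); rewrite {}QE -/(g d) !gM; split.
- by congr g; apply/rowP=> j; rewrite !mxE mulrC.
- set e := \row_j _; rewrite /g !adjM adjK mulmxA /(adj (diag_mx e)) map_diag_mx tr_diag_mx.
  congr (_ *m diag_mx _ *m _); apply/rowP => j; rewrite !mxE.
  have [->|nz] := eqVneq (d 0 j) 0; first by rewrite mul0r rmorph0.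
  by rewrite divff // rmorph1.
congr g; apply/rowP=> j; rewrite !mxE.
by have [->|nz] := eqVneq (d 0 j) 0; rewrite ?mulr0 // divff ?mul1r.
Qed.

Lemma adj_range_proj n (Q : 'M[C]_n) : adj Q = Q ->
  exists S : 'M[C]_n,
    [/\ adj (Q *m S) = Q *m S, Q *m S *m Q = Q, Q *m (Q *m S) = Q &
        forall T, T *m Q = Q *m T -> T *m (Q *m S) = Q *m S *m T].
Proof.
move=> hQ; have [S [SQ hQS QSQ]] := adj_pinv hQ.
have QQS : Q *m (Q *m S) = Q by rewrite -SQ mulmxA.
exists S; split=> // T TQ; transitivity (Q *m S *m T *m (Q *m S)).
  by rewrite !mulmxA -[_ *m T *m Q]mulmxA TQ mulmxA QSQ.
by rewrite -{1}SQ -!mulmxA [Q *m (T *m _)]mulmxA -TQ -!mulmxA QQS TQ !mulmxA SQ.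
Qed.

End Spectral.

(** * Kraus representations of channels *)

Section Kraus.
Variable C : numClosedFieldType.

Definition kraus (I : finType) n (K : I -> 'M[C]_n) (X : 'M[C]_n) : 'M[C]_n :=
  \sum_r K r *m X *m adj (K r).

Lemma kraus_linear (I : finType) n (K : I -> 'M[C]_n) : is_linear_map (kraus K).
Proof.
move=> a X Y; rewrite /kraus scaler_sumr -big_split; apply: eq_bigr => r _ /=.
by rewrite mulmxDr mulmxDl -scalemxAr -scalemxAl.
Qed.

Lemma kraus_adj (I : finType) n (K : I -> 'M[C]_n) X :
  adj (kraus K X) = kraus K (adj X).
Proof.
by rewrite adj_sum; apply: eq_bigr => r _; rewrite !adjM adjK mulmxA.
Qed.

Lemma ipair_mxvec m n (i : 'I_m) (j : 'I_n) : ipair (mxvec_index i j) = (i, j).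
Proof. by rewrite /ipair /mxvec_index cast_ordK enum_rankK. Qed.

Lemma sum_mxvec m n (F : 'I_(m * n) -> C) :
  \sum_p F p = \sum_i \sum_j F (mxvec_index i j).
Proof.
rewrite (reindex _ (curry_mxvec_bij m n)) pair_bigA; by apply: eq_big => [|[i j] _].
Qed.

(** The identity factor forces the ancilla indices to agree and collapses the double sums. Complete
    positivity of a Kraus map thereby reduces to positivity. *)
Lemma tens_id_kraus (I : finType) n k (K : I -> 'M[C]_n) (Z : 'M[C]_(n * k)) :
  tens_id (kraus K) Z = kraus (fun r => kron (K r) (1%:M : 'M_k)) Z.
Proof.
apply/matrixP => p q; rewrite mxE !summxE; apply: eq_bigr => r _.
case/mxvec_indexP: p => a i; case/mxvec_indexP: q => b j; rewrite !ipair_mxvec /=.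
rewrite [LHS]mxE [RHS]mxE sum_mxvec; apply: eq_bigr => b' _.
rewrite (bigD1 j) //= big1 ?addr0 => [|j' /negPf nj]; last first.
  by rewrite !mxE !ipair_mxvec /= eq_sym nj mulr0 rmorph0 mulr0.
rewrite !adjE [in RHS]mxE; congr (_ * _).
  rewrite mxE sum_mxvec; apply: eq_bigr => a' _.
  rewrite (bigD1 i) //= big1 ?addr0 => [|i' /negPf ni].
    by rewrite !mxE !ipair_mxvec /= eqxx mulr1.
  by rewrite mxE !ipair_mxvec /= mxE eq_sym ni mulr0 mul0r.
by rewrite mxE !ipair_mxvec /= mxE eqxx mulr1.
Qed.

Lemma kraus_psd (I : finType) n (K : I -> 'M[C]_n) : positive_map (kraus K).
Proof.
move=> X psdX v; rewrite mulmx_sumr mulmx_suml summxE sumr_ge0 // => r _.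
by have := psdX (adj (K r) *m v); rewrite adjM adjK !mulmxA.
Qed.

Lemma kraus_cp (I : finType) n (K : I -> 'M[C]_n) : completely_positive (kraus K).
Proof. by move=> k X psdX; rewrite tens_id_kraus; apply: kraus_psd. Qed.

Lemma linear_fun_sum m n (F : 'M[C]_m -> 'M[C]_n) (I : finType)
    (c : I -> C) (X : I -> 'M[C]_m) :
    (forall a X Y, F (a *: X + Y) = a *: F X + F Y) ->
  F (\sum_i c i *: X i) = \sum_i c i *: F (X i).
Proof.
move=> linF; apply: (big_rec2 (fun Y Z => F Y = Z)) => [|i Y _ _ <-]; last exact: linF.
by have := linF (-1) 0 0; rewrite scaler0 addr0 scaleN1r addNr.
Qed.

(* The Kraus operators are read off a decomposition of the Choi matrix
   [(E (x) id)(sum_(k, l) e_kl (x) e_kl)] into rank one positive matrices. *)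
Lemma kraus_exists n (E : 'M[C]_n -> 'M[C]_n) :
  is_linear_map E -> completely_positive E ->
  exists K : 'I_(n * n) -> 'M[C]_n, E =1 kraus K.
Proof.
move=> linE cpE.
(* The unnormalised maximally entangled vector, with an ancilla of the same dimension [n]. *)
pose omega : 'cV[C]_(n * n) := \col_p ((ipair p).1 == (ipair p).2)%:R.
have psd_omega : psd (omega *m adj omega).
  move=> v; rewrite mulmxA -mulmxA -{2}[v]adjK -adjM; exact: mulmx_adj_ge0.
have [w wE] := psd_sum_adj (cpE n _ psd_omega).
(* Each vector [w r] of the tensor square is reshaped into an [n] by [n] matrix. *)
exists (fun r => \matrix_(a, k) w r (mxvec_index a k) 0) => X.
have choiE k l : E (delta_mx k l) =
    \matrix_(a, b) \sum_r w r (mxvec_index a k) 0 * (w r (mxvec_index b l) 0)^*.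
  apply/matrixP => a b; rewrite mxE.
  have := congr1 (fun M : 'M_(n * n) => M (mxvec_index a k) (mxvec_index b l)) wE.
  rewrite mxE !ipair_mxvec /= summxE.
  have -> : \matrix_(a0, a') (omega *m adj omega) (mxvec_index a0 k) (mxvec_index a' l)
     = delta_mx k l.
    apply/matrixP => c d; rewrite !mxE big_ord1 adjE !mxE !ipair_mxvec /=.
    by rewrite rmorph_nat -natrM mulnb.
  by move=> ->; apply: eq_bigr => r _; rewrite mxE big_ord1 adjE.
have XE : X = \sum_(p : 'I_n * 'I_n) X p.1 p.2 *: delta_mx p.1 p.2.
  by rewrite {1}[X]matrix_sum_delta pair_bigA.
rewrite {1}XE linear_fun_sum //; apply/matrixP => a b; rewrite !summxE.
under eq_bigr do rewrite choiE !mxE mulr_sumr.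
rewrite exchange_big; apply: eq_bigr => r _ /=.
rewrite mxE; under [RHS]eq_bigr do rewrite mxE mulr_suml.
rewrite exchange_big pair_bigA; apply: eq_bigr => p _ /=.
by rewrite adjE !mxE mulrA [X _ _ * _]mulrC.
Qed.

(** Passage to the Heisenberg picture: the sum on the right is the dual map applied to [Y]. *)
Lemma tr_kraus_mul (I : finType) n (K : I -> 'M[C]_n) X Y :
  \tr (kraus K X *m Y) = \tr (X *m \sum_r adj (K r) *m Y *m K r).
Proof.
rewrite mulmx_suml mulmx_sumr !linear_sum; apply: eq_bigr => r _ /=.
by rewrite -!mulmxA mxtrace_mulC !mulmxA.
Qed.

Lemma kraus_trace (I : finType) n (K : I -> 'M[C]_n) :
  trace_preserving (kraus K) <-> \sum_r adj (K r) *m K r = 1%:M.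
Proof.
have trK X : \tr (kraus K X) = \tr ((\sum_r adj (K r) *m K r) *m X).
  rewrite -[kraus K X]mulmx1 tr_kraus_mul mxtrace_mulC.
  by under eq_bigr do rewrite mulmx1.
split=> [tpK|sumK X]; last by rewrite trK sumK mul1mx.
by apply: eq_mxtrace => Z; rewrite -trK tpK mul1mx.
Qed.

Lemma kraus_channel (I : finType) n (K : I -> 'M[C]_n) (F : 'M[C]_n -> 'M[C]_n) :
  kraus K =1 F -> trace_preserving F -> quantum_channel F.
Proof.
move=> KF tpF; split=> [a X Y|k X psdX v|//]; first by rewrite -!KF kraus_linear.
suff -> : tens_id F X = tens_id (kraus K) X by apply: (kraus_cp K psdX).
by apply/matrixP => p q; rewrite !mxE KF.
Qed.

Lemma channel_kraus n (E : 'M[C]_n -> 'M[C]_n) : quantum_channel E ->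
  exists K : 'I_(n * n) -> 'M[C]_n,
    E =1 kraus K /\ \sum_r adj (K r) *m K r = 1%:M.
Proof.
case=> linE cpE tpE; have [K EK] := kraus_exists linE cpE.
by exists K; split=> //; apply/kraus_trace => X; rewrite -EK tpE.
Qed.

Lemma kraus_comp (I J : finType) n (K : I -> 'M[C]_n) (L : J -> 'M[C]_n) X :
  kraus K (kraus L X) = kraus (fun p : I * J => K p.1 *m L p.2) X.
Proof.
rewrite /kraus; under eq_bigr do rewrite mulmx_sumr mulmx_suml.
by rewrite pair_bigA; apply: eq_bigr => p _; rewrite adjM !mulmxA.
Qed.

(* The sum over [r] of [D_r D_r^*] with [D_r = K_r A - B K_r P] vanishes. *)
Lemma kraus_intertwine (I : finType) n (K : I -> 'M[C]_n) (A B P : 'M[C]_n) :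
    kraus K (A *m adj A) = B *m kraus K (P *m adj A) ->
    kraus K (A *m adj P) *m adj B = B *m kraus K (P *m adj P) *m adj B ->
  forall r, K r *m A = B *m K r *m P.
Proof.
move=> KA KP r; apply/eqP; rewrite -subr_eq0; apply/eqP; move: r.
apply: sum_mulmx_adj_eq0.
(* The four terms of the expanded square are grouped so that each pair cancels by one hypothesis. *)
transitivity (kraus K (A *m adj A) - B *m kraus K (P *m adj A)
  - (kraus K (A *m adj P) *m adj B - B *m kraus K (P *m adj P) *m adj B)).
  rewrite /kraus !(mulmx_sumr, mulmx_suml) -!sumrB; apply: eq_bigr => r _.
  by rewrite adjB !adjM mulmxBr !mulmxBl !mulmxA.
by rewrite KA KP !subrr.
Qed.

End Kraus.

(** * Tensor products, the embedding into the full space, and tracing out a factor *)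

Section Tensor.
Variable C : numClosedFieldType.

Lemma mul_kron m n (A A' : 'M[C]_m) (B B' : 'M[C]_n) :
  kron A B *m kron A' B' = kron (A *m A') (B *m B').
Proof.
apply/matrixP => p q; rewrite !mxE sum_mxvec mulr_suml.
apply: eq_bigr => a _; rewrite mulr_sumr; apply: eq_bigr => i _.
by rewrite !mxE ipair_mxvec mulrACA.
Qed.

Lemma adj_kron m n (A : 'M[C]_m) (B : 'M[C]_n) :
  adj (kron A B) = kron (adj A) (adj B).
Proof. by apply/matrixP => p q; rewrite !mxE rmorphM. Qed.

Lemma kron_linear m n (A : 'M[C]_m) c (X Y : 'M[C]_n) :
  kron A (c *: X + Y) = c *: kron A X + kron A Y.
Proof. by apply/matrixP => p q; rewrite !mxE mulrDr mulrCA. Qed.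

Lemma tens_id_kron m n (F : 'M[C]_m -> 'M[C]_m) (A : 'M[C]_m) (B : 'M[C]_n) :
  is_linear_map F -> tens_id F (kron A B) = kron (F A) B.
Proof.
move=> linF; have F0 : F 0 = 0.
  by have := linF (-1) 0 0; rewrite scaler0 addr0 scaleN1r addNr.
apply/matrixP => p q; rewrite !mxE; set Z := \matrix_(_, _) _.
have -> : Z = B (ipair p).2 (ipair q).2 *: A + 0.
  by apply/matrixP => a b; rewrite !mxE !ipair_mxvec addr0 mulrC.
by rewrite linF F0 addr0 mxE mulrC.
Qed.

Lemma mul_emb n k nc (X Y : 'M[C]_(n * k)) : emb nc X *m emb nc Y = emb nc (X *m Y).
Proof. by rewrite /emb mulmx_block !(mulmx0, mul0mx, addr0). Qed.

Lemma adj_emb n k nc (X : 'M[C]_(n * k)) : adj (emb nc X) = emb nc (adj X).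
Proof. by rewrite /emb /adj map_block_mx tr_block_mx !(map_mx0, trmx0). Qed.

Lemma emb_linear n k nc c (X Y : 'M[C]_(n * k)) :
  emb nc (c *: X + Y) = c *: emb nc X + emb nc Y.
Proof. by rewrite /emb scale_block_mx add_block_mx !(scaler0, addr0). Qed.

Lemma tr_emb n k nc (X : 'M[C]_(n * k)) : \tr (emb nc X) = \tr X.
Proof. by rewrite /emb mxtrace_block mxtrace0 addr0. Qed.

Lemma emb_delta n k nc (p q : 'I_(n * k)) :
  emb nc (delta_mx p q : 'M[C]_(n * k)) = delta_mx (lshift nc p) (lshift nc q).
Proof. by rewrite delta_mx_ushift delta_mx_lshift /emb block_mxEv row_mx0. Qed.

(** Discarding a state and preparing a fixed basis state; this serves as the channel on the first
    factor in the correctability condition. *)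
Lemma trace_out_channel n (a : 'I_n) :
  quantum_channel (fun X : 'M[C]_n => \tr X *: (delta_mx a a : 'M_n)).
Proof.
apply: (@kraus_channel _ _ _ (fun k => delta_mx a k)) => X.
  by rewrite -sum_delta_tr; apply: eq_bigr => k _; rewrite adj_delta.
rewrite mxtraceZ -[RHS]mulr1; congr (_ * _).
by rewrite /mxtrace (bigD1 a) //= big1 ?mxE ?eqxx ?addr0 // => i /negPf ni; rewrite mxE ni.
Qed.

(** The trace coefficients are the matrix entries of the partial trace of [Z] over the first factor.
    In this form the result can be compared with [star_hom_decode]. *)
Lemma trace_out_tens_id n k (a : 'I_n) (Z : 'M[C]_(n * k)) :
  tens_id (fun X : 'M[C]_n => \tr X *: (delta_mx a a : 'M_n)) Z =
  \sum_(p : 'I_k * 'I_k) \tr (Z *m kron 1%:M (delta_mx p.2 p.1)) *: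
    delta_mx (mxvec_index a p.1) (mxvec_index a p.2).
Proof.
have trZ i j : \tr (Z *m kron 1%:M (delta_mx j i)) =
    \sum_b Z (mxvec_index b i) (mxvec_index b j).
  rewrite /mxtrace sum_mxvec; apply: eq_bigr => b _.
  rewrite (bigD1 i) //= [X in _ + X]big1 ?addr0 => [|l /negPf nl]; last first.
    by rewrite mxE big1 // => q _; rewrite !mxE ipair_mxvec nl andbF !mulr0.
  rewrite mxE sum_mxvec (bigD1 b) //= [X in _ + X]big1 ?addr0 => [|c /negPf nc].
    rewrite (bigD1 j) //= big1 ?addr0 => [|l /negPf nl].
      by rewrite !mxE !ipair_mxvec !eqxx !mulr1.
    by rewrite !mxE !ipair_mxvec nl !mulr0.
  by rewrite big1 // => l _; rewrite !mxE !ipair_mxvec nc mul0r mulr0.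
have idxE b i c j : (mxvec_index b i == mxvec_index c j :> 'I_(n * k)) = ((b, i) == (c, j)).
  by apply/eqP/eqP => [/(congr1 (@ipair n k))|[-> ->]//]; rewrite !ipair_mxvec.
apply/matrixP => p q; case/mxvec_indexP: p => b i; case/mxvec_indexP: q => c j.
rewrite mxE !ipair_mxvec /= summxE (bigD1 (i, j)) //= big1 ?addr0 => [|[i' j']].
  rewrite trZ !mxE !idxE !xpair_eqE !eqxx !andbT; congr (_ * _).
  by apply: eq_bigr => d _; rewrite mxE.
rewrite xpair_eqE !mxE !idxE !xpair_eqE ![_ == i']eq_sym ![_ == j']eq_sym.
by case: (i' == i) => //; case: (j' == j); rewrite // !andbF mulr0.
Qed.

End Tensor.

(** * The decoding channel of a star-homomorphism *)

Section StarHomChannel.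
Variable C : numClosedFieldType.
Variables (k n : nat) (phi : 'M[C]_k -> 'M[C]_n).
Hypothesis phi_linear : forall a X Y, phi (a *: X + Y) = a *: phi X + phi Y.
Hypothesis phiM : forall X Y, phi (X *m Y) = phi X *m phi Y.
Hypothesis phi_adj : forall X, phi (adj X) = adj (phi X).

(* [phi] embeds a copy of the [k]-level system: its reduced state, with matrix entries
   [tr (X phi(e_ji))], is copied to the coordinates [q], and the weight outside the
   support of [phi] is dumped on the coordinate [q i0]. *)
Definition star_hom_decode (q : 'I_k -> 'I_n) (i0 : 'I_k) (X : 'M[C]_n) : 'M[C]_n :=
  (\sum_(p : 'I_k * 'I_k) \tr (X *m phi (delta_mx p.2 p.1)) *: delta_mx (q p.1) (q p.2))
  + \tr (X *m (1%:M - phi 1%:M)) *: delta_mx (q i0) (q i0).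

Lemma star_hom_decode_channel (q : 'I_k -> 'I_n) (i0 : 'I_k) :
  injective q -> quantum_channel (star_hom_decode q i0).
Proof.
move=> q_inj.
(* The index [r] expands a trace over the basis. The [inl] family yields the entries because [phi]
   maps [e_(j,i0) e_(i0,i)] to [phi(e_ji)]; the [inr] family works because [1 - phi(1)] is a
   projection. *)
pose T (s : 'I_n + 'I_n) : 'M[C]_n := match s with
  | inl r => \sum_i delta_mx (q i) r *m phi (delta_mx i0 i)
  | inr r => delta_mx (q i0) r *m (1%:M - phi 1%:M) end.
have krausT : kraus T =1 star_hom_decode q i0.
  move=> X; rewrite /kraus big_sumType /=; congr (_ + _).
    transitivity (\sum_(p : 'I_k * 'I_k) \sum_r delta_mx (q p.1) r *m
        (phi (delta_mx i0 p.1) *m X *m adj (phi (delta_mx i0 p.2))) *m delta_mx r (q p.2)).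
      rewrite exchange_big; apply: eq_bigr => r _ /=.
      rewrite adj_sum !mulmx_suml; under [LHS]eq_bigr do rewrite mulmx_sumr.
      by rewrite pair_bigA; apply: eq_bigr => p _; rewrite adjM adj_delta !mulmxA.
    apply: eq_bigr => p _; rewrite sum_delta_tr tr_adj_mul -phi_adj -phiM.
    by rewrite adj_delta mul_delta_mx.
  have proj_e : adj (1%:M - phi 1%:M) *m (1%:M - phi 1%:M) = 1%:M - phi 1%:M.
    rewrite adjB adj1 -phi_adj adj1 mulmxBl mul1mx mulmxBr mulmx1 -phiM mulmx1.
    by rewrite subrr subr0.
  rewrite -[in RHS]proj_e -tr_adj_mul -sum_delta_tr; apply: eq_bigr => r _.
  by rewrite adjM adj_delta !mulmxA.
have tr_delta i j : \tr (delta_mx (q i) (q j) : 'M[C]_n) = (i == j)%:R.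
  by rewrite -(mul_delta_mx (0 : 'I_1)) mxtrace_mulC mul_delta_mx_cond
    (inj_eq q_inj) eq_sym raddfMn /= trace_mx11 mxE.
(* By injectivity of [q] only diagonal pairs contribute to the trace, giving [tr (X phi(1))]; the
   dumped term supplies the rest of [tr X]. *)
apply: (kraus_channel krausT) => X; rewrite /star_hom_decode.
rewrite mxtraceD mxtraceZ tr_delta eqxx mulr1 linear_sum /=.
under eq_bigr do rewrite mxtraceZ tr_delta.
rewrite -(pair_bigA _ (fun i j => \tr (X *m phi (delta_mx j i)) * (i == j)%:R)) /=.
under eq_bigr => i _.
  rewrite (bigD1 i) //= big1 ?addr0 ?eqxx ?mulr1 => [|j /negPf nj]; last first.
    by rewrite eq_sym nj mulr0.
  over.
rewrite -linear_sum /= -mulmx_sumr /=.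
have -> : \sum_i phi (delta_mx i i) = phi 1%:M.
  rewrite mx1_sum_delta; under eq_bigr do rewrite -[phi _]scale1r.
  by rewrite -linear_fun_sum //; under eq_bigr do rewrite scale1r.
by rewrite -mxtraceD -mulmxDr addrC subrK mulmx1.
Qed.

End StarHomChannel.

(** * The two implications for the subsystem *)

Section Subsystem.
Variables (C : numClosedFieldType) (na nb nc : nat).
Local Notation n := (na * nb + nc)%N.
Local Notation P := (PC C na nb nc).
Implicit Types (E : 'M[C]_n -> 'M[C]_n) (X : 'M[C]_n) (Y : 'M[C]_nb).

Definition ampl Y : 'M[C]_n := emb nc (kron (1%:M : 'M[C]_na) Y).

Lemma mul_ampl Y Y' : ampl Y *m ampl Y' = ampl (Y *m Y').
Proof. by rewrite mul_emb mul_kron mulmx1. Qed.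

Lemma adj_ampl Y : adj (ampl Y) = ampl (adj Y).
Proof. by rewrite adj_emb adj_kron adj1. Qed.

Lemma ampl_linear (c : C) Y Y' : ampl (c *: Y + Y') = c *: ampl Y + ampl Y'.
Proof. by rewrite /ampl kron_linear emb_linear. Qed.

Lemma PC_ampl : P = ampl 1%:M.
Proof. by []. Qed.

Lemma mul_PC_ampl Y : P *m ampl Y = ampl Y.
Proof. by rewrite PC_ampl mul_ampl mul1mx. Qed.

Lemma mul_ampl_PC Y : ampl Y *m P = ampl Y.
Proof. by rewrite PC_ampl mul_ampl mulmx1. Qed.

Lemma adj_PC : adj P = P.
Proof. by rewrite PC_ampl adj_ampl adj1. Qed.

Lemma projC_emb X : projC X = emb nc (ulsubmx (projC X)).
Proof.
rewrite /projC /PC; set I1 := kron _ _; rewrite -[X]submxK /emb !mulmx_block.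
by rewrite !(mulmx0, mul0mx, addr0) block_mxKul.
Qed.

Lemma projC_ampl Y : projC (ampl Y) = ampl Y.
Proof. by rewrite /projC mul_PC_ampl mul_ampl_PC. Qed.

Lemma tr_projC_ampl X Y : \tr (projC X *m ampl Y) = \tr (X *m ampl Y).
Proof.
rewrite /projC -mulmxA mul_PC_ampl -mulmxA mxtrace_mulC.
by rewrite -mulmxA mul_ampl_PC.
Qed.

(** [theta] is the Heisenberg dual of the recovery channel. It is not yet multiplicative, but it
    already intertwines the Kraus operators of [E]. *)
Lemma correctable_kraus E : is_linear_map E -> correctable_subsystem E ->
  forall (I : finType) (K : I -> 'M[C]_n), E =1 kraus K ->
  exists theta : 'M[C]_n -> 'M[C]_n,
   [/\ forall a X X', theta (a *: X + X') = a *: theta X + theta X',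
       forall X, theta (adj X) = adj (theta X) &
       forall r Y, K r *m ampl Y = theta (ampl Y) *m K r *m P].
Proof.
move=> linE [R [FA [chanR [linFA _ _] RE]]] I K EK.
have [T [RT sumT]] := channel_kraus chanR.
have REampl Y : R (E (ampl Y)) = emb nc (kron (FA 1%:M) Y).
  by rewrite -projC_ampl RE projC_ampl /ampl /emb block_mxKul tens_id_kron.
pose M (p : 'I_(n * n) * I) := T p.1 *m K p.2.
have krausM Y : kraus M (ampl Y) = emb nc (kron (FA 1%:M) Y).
  by rewrite -REampl RT EK kraus_comp.
(* The composite channel leaves the second tensor factor untouched, so [ampl Y] can be pulled out of
   its output on either side. *)
have commM p Y : M p *m ampl Y = ampl Y *m M p *m P.
  apply: kraus_intertwine; rewrite ?adj_PC adj_ampl ?mul_PC_ampl ?mul_ampl_PC ?mul_ampl.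
    by rewrite !krausM mul_emb mul_kron mul1mx.
  by rewrite !krausM !mul_emb !mul_kron !mul1mx !mulmx1.
exists (fun X => \sum_r adj (T r) *m X *m T r); split.
- move=> a X X'; rewrite scaler_sumr -big_split; apply: eq_bigr => r _ /=.
  by rewrite mulmxDr mulmxDl -scalemxAr -scalemxAl.
- move=> X; rewrite adj_sum; apply: eq_bigr => r _.
  by rewrite !adjM adjK mulmxA.
move=> r Y; rewrite -{1}[K r]mul1mx -sumT !mulmx_suml; apply: eq_bigr => s _.
by have := commM (s, r) Y; rewrite /M /= -!mulmxA => ->.
Qed.

Lemma correctable_star_hom E : quantum_channel E -> correctable_subsystem E ->
  exists pi : 'M[C]_n -> 'M[C]_n,
    star_hom_on_AB pi /\
    forall rho, in_AB rho -> E rho = pi rho *m E P /\ E rho = E P *m pi rho.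
Proof.
move=> chanE corrE; have [K [EK _]] := channel_kraus chanE.
have [linE _ _] := chanE.
have [theta [theta_lin theta_adj thetaK]] := correctable_kraus linE corrE EK.
have thetaE Y Y' : theta (ampl Y) *m E (ampl Y') = E (ampl (Y *m Y')).
  rewrite !EK mulmx_sumr; apply: eq_bigr => r _.
  by rewrite -mul_ampl !mulmxA thetaK -!mulmxA [P *m (_ *m _)]mulmxA mul_PC_ampl.
have adjE Y : adj (E (ampl Y)) = E (ampl (adj Y)) by rewrite !EK kraus_adj adj_ampl.
have thetaQ Y : theta (ampl Y) *m E P = E (ampl Y).
  by rewrite PC_ampl thetaE mulmx1.
have adjQ : adj (E P) = E P by rewrite PC_ampl adjE adj1.
have Qtheta Y : E P *m theta (ampl Y) = E (ampl Y).
  by rewrite -[LHS]adjK adjM -theta_adj adj_ampl adjQ thetaQ adjE adjK.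
have [S [adjS QSQ QQS commS]] := adj_range_proj adjQ.
set Q := E P in thetaQ adjQ Qtheta adjS QSQ QQS commS *.
have comm_theta Y : theta (ampl Y) *m (Q *m S) = Q *m S *m theta (ampl Y).
  by apply: commS; rewrite thetaQ Qtheta.
exists (fun X => theta X *m (Q *m S)); split; first split.
- by move=> a X X' _ _; rewrite theta_lin mulmxDl scalemxAl.
- move=> _ _ [Y ->] [Y' ->]; rewrite -/(ampl Y) -/(ampl Y') mul_ampl.
  (* The inner projection is moved to the right and merged with the outer one, leaving
     [theta *m theta *m Q *m S]; next to [Q] the map [theta] is multiplicative by [thetaE]. *)
  rewrite [RHS]mulmxA -[_ *m (Q *m S) *m _]mulmxA -comm_theta.
  rewrite -!mulmxA [Q *m (S *m _)]mulmxA [Q *m S *m _]mulmxA QSQ.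
  by rewrite !mulmxA thetaQ -[in RHS](mulmxA _ _ Q) thetaQ thetaE.
- move=> _ [Y ->]; rewrite -/(ampl Y) comm_theta.
  by rewrite adj_ampl comm_theta adjM adjS -theta_adj adj_ampl.
move=> _ [Y ->]; rewrite -/(ampl Y); split.
  by rewrite -[RHS]mulmxA QSQ thetaQ.
by rewrite comm_theta mulmxA QQS Qtheta.
Qed.

Lemma star_hom_correctable E (pi : 'M[C]_n -> 'M[C]_n) :
    quantum_channel E -> star_hom_on_AB pi ->
    (forall rho, in_AB rho -> E rho = pi rho *m E P /\ E rho = E P *m pi rho) ->
  correctable_subsystem E.
Proof.
move=> chanE [pi_lin piM pi_adj] piE.
have [K [EK sumK]] := channel_kraus chanE; have [linE _ tpE] := chanE.
have inL Y : in_AB (ampl Y) by exists Y.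
(* When the code space is zero there is no basis state to prepare, but both sides of the
   correctability equation vanish and identity channels suffice. *)
case: (posnP (na * nb)) => [nab0 | /[!muln_gt0] /andP[na_gt0 nb_gt0]].
  have Z0 (Z : 'M[C]_(na * nb)) : Z = 0.
    by apply/matrixP => -[i ltin]; have := ltin; rewrite [X in (_ < X)%N]nab0.
  have chan_id m : quantum_channel (@id 'M[C]_m).
    apply: (@kraus_channel _ 'I_1 _ (fun=> 1%:M)) => // X.
    by rewrite /kraus big_ord1 adj1 mulmx1 mul1mx.
  exists id, id; split=> // rho.
  rewrite projC_emb [ulsubmx _]Z0 [tens_id _ _]Z0 /emb block_mx_const.
  by have := linE (-1) 0 0; rewrite scaler0 addr0 scaleN1r addNr.
pose a0 := Ordinal na_gt0; pose i0 := Ordinal nb_gt0.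
pose phi Y := pi (ampl Y).
have phi_lin (c : C) Y Y' : phi (c *: Y + Y') = c *: phi Y + phi Y'.
  by rewrite /phi ampl_linear pi_lin.
have phiM Y Y' : phi (Y *m Y') = phi Y *m phi Y' by rewrite /phi -mul_ampl piM.
have phi_adj Y : phi (adj Y) = adj (phi Y) by rewrite /phi -adj_ampl pi_adj.
have EP Y : E (ampl Y) = phi Y *m E P by case: (piE _ (inL Y)).
have commK r Y : K r *m ampl Y = phi Y *m K r *m P.
  apply: kraus_intertwine; rewrite ?adj_PC ?adj_ampl ?mul_PC_ampl ?mul_ampl_PC ?mul_ampl.
    by rewrite -!EK (EP (Y *m _)) (EP (adj Y)) phiM mulmxA.
  by rewrite -!EK EP.
(* Places the basis of the second factor beside the state [a0], the same state that the channel on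
   the first factor prepares. *)
pose q i : 'I_n := lshift nc (mxvec_index a0 i).
have q_inj : injective q.
  move=> i j /lshift_inj /(congr1 (@ipair na nb)); rewrite !ipair_mxvec.
  by case.
(* In the Heisenberg picture, [commK] and trace preservation show that the dual of [E] sends [phi Y]
   to an operator whose product with the code projection on the right is [ampl Y]. *)
have dual X Y : \tr (E (projC X) *m phi Y) = \tr (X *m ampl Y).
  rewrite EK tr_kraus_mul; set W := \sum_r _.
  rewrite /projC -!mulmxA mxtrace_mulC -!mulmxA; congr (\tr (_ *m _)).
  rewrite /W mulmx_suml -[RHS]mul_PC_ampl -[ampl Y]mul1mx -sumK mulmx_suml.
  congr (_ *m _); apply: eq_bigr => r _.
  by rewrite -!mulmxA commK !mulmxA.
exists (star_hom_decode phi q i0), (fun X : 'M[C]_na => \tr X *: (delta_mx a0 a0 : 'M_na)).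
split=> [||rho]; [exact: star_hom_decode_channel | exact: trace_out_channel |].
(* No weight is dumped: by [dual] at the identity and trace preservation, the output lies entirely
   in the support of [phi]. *)
have tr0 : \tr (E (projC rho) *m (1%:M - phi 1%:M)) = 0.
  rewrite mulmxBr mulmx1 linearB /= tpE dual -tr_projC_ampl /projC -(mulmxA (P *m rho)).
  by rewrite mul_PC_ampl subrr.
rewrite trace_out_tens_id /star_hom_decode tr0 scale0r addr0.
rewrite linear_fun_sum; last exact: emb_linear.
apply: eq_bigr => p _; rewrite emb_delta dual -tr_projC_ampl.
by rewrite {1}projC_emb mul_emb tr_emb.
Qed.

End Subsystem.

Theorem theorem5 (C : numClosedFieldType) (na nb nc : nat)
  (E : 'M[C]_(na * nb + nc) -> 'M[C]_(na * nb + nc)) :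
  quantum_channel E ->
  (correctable_subsystem E <->
   exists pi : 'M[C]_(na * nb + nc) -> 'M[C]_(na * nb + nc),
     star_hom_on_AB pi /\
     forall rho, @in_AB C na nb nc rho ->
       E rho = pi rho *m E (PC C na nb nc) /\
       E rho = E (PC C na nb nc) *m pi rho).
Proof.
move=> chanE; split; first exact: correctable_star_hom.
by case=> pi [homPi piE]; apply: star_hom_correctable chanE homPi piE.
Qed.
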